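(* Consider two-player nim with $k\ge1$ piles of initial sizes $s_1,\dots,s_k\ge1$, played either under misère play (the player removing the last token loses) or normal play (the player removing the last token wins). On each turn, if the current nonempty pile sizes are $t_1,\dots,t_m$, the legal moves are ''remove $r$ tokens from pile $j$'' for $1\le r\le t_j$, and the player to move chooses one of these $t_1+\dots+t_m$ moves uniformly at random, independently of all previous choices. Then: (a) the expected number of moves played is $\sum_{i=1}^k\sum_{r=1}^{s_i}\frac1r=\sum_{i=1}^k H_{s_i}$, where $H_t=\sum_{r=1}^t\frac1r$; (b) if every pile has size $1$, the game lasts exactly $k$ turns, and the winner depends only on whether $k$ is even or odd; (c) otherwise, if at least one pile has size greater than $1$, each player wins with probability $1/2$. *)

(* Defs.v *)
From mathcomp Require Import all_boot all_order all_algebra.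
From mathcomp Require Import all_classical all_reals all_analysis.

Set Implicit Arguments.
Unset Strict Implicit.
Unset Printing Implicit Defensive.

Import Order.TTheory GRing.Theory Num.Theory.

Local Open Scope classical_set_scope.
Local Open Scope ring_scope.

(* Piles keep their index for the whole game; an exhausted pile has size 0 and
   offers no legal move. *)
Definition position (k : nat) := {ffun 'I_k -> nat}.

(* The pair (j, r) stands for "remove r tokens from pile j". *)
Definition move (k : nat) := ('I_k * nat)%type.

Definition legal (k : nat) (t : position k) (m : move k) : bool :=
  (1 <= m.2 <= t m.1)%N.

Definition after_move (k : nat) (t : position k) (m : move k) : position k :=
  [ffun i => if i == m.1 then (t i - m.2)%N else t i].

Definition after (k : nat) (t : position k) (h : seq (move k)) : position k :=
  foldl (@after_move k) t h.

Fixpoint legal_moves (k : nat) (t : position k) (h : seq (move k)) : bool :=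
  if h is m :: h' then legal t m && legal_moves (after_move t m) h' else true.

(* Total number of tokens, which is also the number of legal moves. *)
Definition tokens (k : nat) (t : position k) : nat := (\sum_(i < k) t i)%N.

Definition complete_play (k : nat) (t : position k) (h : seq (move k)) : bool :=
  legal_moves t h && (tokens (after t h) == 0%N).

Inductive player := Player1 | Player2.

Definition opponent (p : player) : player :=
  match p with Player1 => Player2 | Player2 => Player1 end.

(* Moves are numbered from 0, and Player1 makes move number 0. *)
Definition mover (n : nat) : player := if odd n then Player2 else Player1.

Inductive convention := Normal | Misere.

(* In a complete play of a game that starts with at least one token, the last
   token is removed by the last move, which has number (size h).-1. *)
Definition winner (c : convention) (k : nat) (h : seq (move k)) : player :=
  let last_mover := mover (size h).-1 in
  match c with Normal => last_mover | Misere => opponent last_mover end.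

(* [play w] is the whole sequence of moves made in the outcome w. The last
   field says that, given that the play starts with the moves h and that this
   does not end the game, the next move is conditionally uniform among the legal
   ones (with the conditional probability multiplied out): each choice is
   uniform and independent of all the previous ones. *)
Record random_play (R : realType) (d : measure_display) (T : measurableType d)
    (P : probability T R) (k : nat) (s : position k)
    (play : T -> seq (move k)) : Prop := RandomPlay {
  random_play_measurable :
    forall A : set (seq (move k)), measurable (play @^-1` A) ;
  random_play_complete : forall w : T, complete_play s (play w) ;
  random_play_uniform : forall (h : seq (move k)) (m : move k),
    legal_moves s h -> legal (after s h) m ->
    P [set w | prefix (rcons h m) (play w)] =
      (P [set w | prefix h (play w)] * ((tokens (after s h))%:R^-1)%:E)%E
}.

Definition harmonic_number (R : realType) (t : nat) : R :=
  \sum_(1 <= r < t.+1) (r%:R)^-1.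

(* Main.v *)
(* Both results come from martingales along the random play, that is, from
   functionals W of the history whose average over the legal next moves is their
   current value; the expectation of W at the end of the play is then its initial
   value.

   For the expected length, W is the number of moves made so far plus the sum of
   H_t over the current piles t. It is a martingale because
   H_0 + ... + H_(t-1) = t * H_t - t.

   For the winner, W is (-1)^(number of moves made) times the product over the
   current piles t of phi(t), where phi(0) = 1, phi(1) = -1 and phi(t) = 0 for
   t > 1. It is a martingale because phi(0) + ... + phi(t-1) = - t * phi(t). Its
   initial value is 0 as soon as some pile has size greater than 1, so the length
   of the play is then odd with probability 1/2. *)
Require Import Defs.
From mathcomp Require Import all_boot all_order all_algebra.
From mathcomp Require Import all_classical all_reals all_analysis.
From mathcomp Require Import measurable_realfun ring lra.

Set Implicit Arguments.
Unset Strict Implicit.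
Unset Printing Implicit Defensive.

Import Order.TTheory GRing.Theory Num.Theory.

Local Open Scope classical_set_scope.
Local Open Scope ring_scope.

(** * Legal moves as a finite list *)

Definition moves (k : nat) (t : position k) : seq (move k) :=
  [seq (j, r) | j <- index_enum 'I_k, r <- index_iota 1 (t j).+1].

Definition set_pile (k : nat) (t : position k) (j : 'I_k) (u : nat) :
    position k :=
  [ffun i => if i == j then u else t i].

Lemma mem_moves (k : nat) (t : position k) (m : move k) :
  (m \in moves t) = legal t m.
Proof.
apply/allpairsPdep/idP => [[j [r [_ + ->]]]|lm].
  by rewrite mem_index_iota /legal /= ltnS.
case: m lm => j r lm; exists j, r.
by split; rewrite ?mem_index_enum // mem_index_iota ltnS.
Qed.

Lemma moves_uniq (k : nat) (t : position k) : uniq (moves t).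
Proof.
apply: allpairs_uniq_dep => [|j _|[? ?] [? ?] _ _ [-> ->] //].
  exact: index_enum_uniq.
exact: iota_uniq.
Qed.

Lemma after_rcons (k : nat) (t : position k) (h : seq (move k)) (m : move k) :
  after t (rcons h m) = after_move (after t h) m.
Proof. by rewrite /after foldl_rcons. Qed.

Lemma legal_moves_cat (k : nat) (t : position k) (h h' : seq (move k)) :
  legal_moves t (h ++ h') = legal_moves t h && legal_moves (after t h) h'.
Proof. by elim: h t => //= m h IH t; rewrite IH andbA. Qed.

Lemma tokens_after_move (k : nat) (t : position k) (m : move k) :
  legal t m -> (tokens (after_move t m) + m.2 = tokens t)%N.
Proof.
move=> /andP[_ le_mt]; rewrite /tokens (bigD1 m.1) //= [RHS](bigD1 m.1) //=.
rewrite ffunE eqxx addnAC subnK //; congr (_ + _)%N.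
by apply: eq_bigr => i /negPf im; rewrite ffunE im.
Qed.

Lemma tokens0_not_legal (k : nat) (t : position k) (m : move k) :
  tokens t = 0%N -> ~~ legal t m.
Proof.
move=> t0; apply/negP => lm; have := tokens_after_move lm; rewrite t0.
by case/andP: lm; case: m => j [|r] //=; rewrite addnS.
Qed.

Lemma tokens0_pile (k : nat) (t : position k) :
  tokens t = 0%N -> forall i, t i = 0%N.
Proof.
by move=> /eqP; rewrite sum_nat_eq0 => /forallP t0 i; apply/eqP/(implyP (t0 i)).
Qed.

(** * Sums over the legal moves *)

Section sum_moves.
Context {R : comNzRingType}.

(** The legal moves in pile [j] leave each size [u < t j] exactly once, so a sum over removals
    becomes a sum over the sizes left. *)
Lemma sum_moves_set_pile (k : nat) (t : position k) (F : position k -> R) :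
  \sum_(m <- moves t) F (after_move t m) =
  \sum_(j < k) \sum_(0 <= u < t j) F (set_pile t j u).
Proof.
rewrite big_allpairs_dep; apply: eq_bigr => j _.
rewrite big_add1 big_nat_rev /=; apply: eq_big_nat => r /andP[_ rt].
congr F; apply/ffunP => i; rewrite !ffunE /=; case: eqP => // ->.
by rewrite add0n subnSK // subKn // ltnW.
Qed.

Lemma sum_moves_const (k : nat) (t : position k) (x : R) :
  \sum_(m <- moves t) x = (tokens t)%:R * x.
Proof.
rewrite (sum_moves_set_pile t (fun=> x)) /tokens natr_sum mulr_suml.
by apply: eq_bigr => j _; rewrite sumr_const_nat subn0 mulr_natl.
Qed.

Lemma big_set_pile (op : R -> R -> R) (x : R) (k : nat) (t : position k)
    (j : 'I_k) (u : nat) (f : nat -> R) :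
  \big[op/x]_(i < k | i != j) f (set_pile t j u i) =
  \big[op/x]_(i < k | i != j) f (t i).
Proof. by apply: eq_bigr => i /negPf ij; rewrite ffunE ij. Qed.

(* The hypothesis says that [phi] is an eigenfunction, with eigenvalue -1, of
   the transition kernel of the one-pile game; the product inherits this. *)
Lemma sum_moves_prod (k : nat) (t : position k) (phi : nat -> R) :
  (forall n, \sum_(0 <= u < n) phi u = - (n%:R * phi n)) ->
  \sum_(m <- moves t) \prod_(i < k) phi (after_move t m i) =
  - ((tokens t)%:R * \prod_(i < k) phi (t i)).
Proof.
move=> phiE.
rewrite (sum_moves_set_pile t (fun t' => \prod_(i < k) phi (t' i))).
rewrite /tokens natr_sum mulr_suml -sumrN; apply: eq_bigr => j _.
rewrite [in RHS](bigD1 j) //= mulrA -mulNr -phiE mulr_suml.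
apply: eq_bigr => u _; rewrite (bigD1 j) //= ffunE eqxx; congr (_ * _).
exact: big_set_pile.
Qed.

(** The hypothesis says that a random move in a single nonempty pile lowers [f] by 1 on average. A
    move alters one summand only, so the whole sum behaves alike. *)
Lemma sum_moves_sum (k : nat) (t : position k) (f : nat -> R) :
  (forall n, \sum_(0 <= u < n) f u = n%:R * f n - n%:R) ->
  \sum_(m <- moves t) \sum_(i < k) f (after_move t m i) =
  (tokens t)%:R * (\sum_(i < k) f (t i) - 1).
Proof.
move=> fE.
rewrite (sum_moves_set_pile t (fun t' => \sum_(i < k) f (t' i))).
rewrite /tokens natr_sum mulr_suml; apply: eq_bigr => j _.
under eq_bigr => u _.
  rewrite (bigD1 j) //= ffunE eqxx big_set_pile; over.
rewrite big_split /= fE sumr_const_nat subn0 [in RHS](bigD1 j) //=.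
by rewrite -mulr_natl; ring.
Qed.

End sum_moves.

(** * Integration along the random play *)

Section random_play.
Context {R : realType} {d : measure_display} {T : measurableType d}.
Context {P : probability T R} {k : nat} {s : position k}.
Context {play : T -> seq (move k)}.
Context (rp : random_play P s play).

Let extends (h : seq (move k)) : set T := [set w | prefix h (play w)].

Lemma extends_complete (h : seq (move k)) (w : T) :
  tokens (after s h) = 0%N -> extends h w -> play w = h.
Proof.
move=> h0 /prefixP[[|m h'] e]; first by rewrite e cats0.
have /andP[] := random_play_complete rp w.
rewrite e legal_moves_cat /= => /andP[_ /andP[]].
by rewrite (negPf (tokens0_not_legal _ h0)).
Qed.

Lemma extends_step (h : seq (move k)) :
  tokens (after s h) != 0%N ->
  extends h = \big[setU/set0]_(m <- moves (after s h)) extends (rcons h m).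
Proof.
move=> h0; rewrite -bigcup_seq; apply/seteqP; split => w /=; last first.
  by move=> [m _] /(prefix_trans (prefix_rcons _ _)).
(* A complete play cannot stop at [h], where tokens remain. *)
move=> /prefixP[[|m h'] e]; have /andP[] := random_play_complete rp w.
  by rewrite e cats0 (negPf h0).
rewrite e legal_moves_cat /= => /andP[_ /andP[lm _]] _.
by exists m; rewrite /= ?mem_moves // /extends /= e -cat_rcons prefix_prefix.
Qed.

Lemma extends_trivIset (h : seq (move k)) (A : set (move k)) :
  trivIset A (fun m => extends (rcons h m)).
Proof.
move=> m m' _ _ [w [/prefixP[h1 e] /prefixP[h2]]].
by rewrite e !cat_rcons => /eqP; rewrite eqseq_cat // eqxx /= => /eqP[].
Qed.

(* Nonnegativity spares any integrability argument. The proof shows, by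
   induction on the number of tokens left, that the integral of [W (play w)]
   over the plays extending [h] is [P (extends h) * W h]. *)
Lemma integral_play_martingale (W : seq (move k) -> R) :
  (forall h, 0 <= W h) ->
  (forall h, \sum_(m <- moves (after s h)) W (rcons h m) =
             (tokens (after s h))%:R * W h) ->
  (\int[P]_w (W (play w))%:E = (W [::])%:E)%E.
Proof.
move=> W0 Wstep.
have mW D : measurable D -> measurable_fun D (EFin \o W \o play).
  move=> mD _ Y mY; apply: measurableI => //.
  exact: (random_play_measurable rp ((fun h => (W h)%:E) @^-1` Y)).
have mext h : measurable (extends h).
  exact: (random_play_measurable rp [set h' | prefix h h']).
suff main n h : (tokens (after s h) <= n)%N -> legal_moves s h ->
    (\int[P]_(w in extends h) (W (play w))%:E = P (extends h) * (W h)%:E)%E.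
  have extT : extends [::] = setT.
    by apply/seteqP; split => // w _; rewrite /extends /= prefix0s.
  have := main _ [::] (leqnn _) isT.
  by rewrite extT probability_setT mul1e.
(* With no token left, every play extending [h] is [h] itself, so the integrand is constant; this
   settles that case for both values of the bound. *)
elim: n h => [|n IH] h hn lh; have [h0|h0] := eqVneq (tokens (after s h)) 0%N;
  try by rewrite (eq_integral (cst (W h)%:E)) ?integral_cst 1?muleC // => w;
    rewrite inE => /(extends_complete h0) ->.
  by move: hn; rewrite leqn0 (negPf h0).
have hstep m : m \in moves (after s h) ->
    (\int[P]_(w in extends (rcons h m)) (W (play w))%:E =
     P (extends h) * ((tokens (after s h))%:R^-1)%:E * (W (rcons h m))%:E)%E.
  rewrite mem_moves => lm; rewrite IH ?(random_play_uniform rp lh lm) //.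
    rewrite after_rcons -ltnS; apply: leq_trans hn.
    rewrite -(tokens_after_move lm) -[ltnLHS]addn0 ltn_add2l.
    by case/andP: lm.
  by rewrite -cats1 legal_moves_cat lh /= lm.
rewrite {1}(extends_step h0) ge0_integral_bigsetU //; last 4 first.
- exact: moves_uniq.
- exact: extends_trivIset.
- by apply: mW; rewrite -extends_step.
- by move=> w _; rewrite lee_fin.
rewrite (eq_big_seq _ hstep).
(* Finiteness moves the sum into [R], where [Wstep] applies and the token count cancels the uniform
   weight. *)
have Pfin : P (extends h) \is a fin_num by exact: fin_num_measure.
rewrite -(fineK Pfin); under eq_bigr do rewrite -!EFinM.
rewrite sumEFin -mulr_sumr Wstep -EFinM; congr _%:E.
by rewrite -mulrA mulKf // pnatr_eq0.
Qed.

End random_play.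

(** * The two martingales: length, then parity *)

Lemma harmonic_number0 (R : realType) : harmonic_number R 0 = 0.
Proof. by rewrite /harmonic_number big_geq. Qed.

Lemma harmonic_numberS (R : realType) (n : nat) :
  harmonic_number R n.+1 = harmonic_number R n + n.+1%:R^-1.
Proof. by rewrite /harmonic_number big_nat_recr. Qed.

Lemma harmonic_number_ge0 (R : realType) (n : nat) : 0 <= harmonic_number R n.
Proof. by apply: sumr_ge0 => i _; rewrite invr_ge0. Qed.

Lemma sum_harmonic_number (R : realType) (n : nat) :
  \sum_(0 <= u < n) harmonic_number R u = n%:R * harmonic_number R n - n%:R.
Proof.
elim: n => [|n IH]; first by rewrite big_geq // !mul0r subr0.
rewrite big_nat_recr //= IH harmonic_numberS -natr1.
by field; rewrite natr1 pnatr_eq0.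
Qed.

Lemma expectation_size_play {R : realType} {d : measure_display}
    {T : measurableType d} {P : probability T R} {k : nat} {s : position k}
    {play : T -> seq (move k)} :
  random_play P s play ->
  ('E_P[fun x => (size (play x))%:R] =
    (\sum_(i < k) harmonic_number R (s i))%:E)%E.
Proof.
move=> rp; rewrite expectation.unlock.
pose W h : R := (size h)%:R + \sum_(i < k) harmonic_number R (after s h i).
transitivity (W [::])%:E; last by rewrite /W add0r.
rewrite -(integral_play_martingale rp (W := W)).
(* At the end all piles are 0 and H_0 = 0, so [W] is the length. *)
- apply: eq_integral => w _; congr _%:E; rewrite /W.
  have /andP[_ /eqP e0] := random_play_complete rp w.
  rewrite big1 ?addr0 // => i _.
  by rewrite tokens0_pile // harmonic_number0.
- by move=> h; rewrite addr_ge0 // sumr_ge0 // => i _; exact: harmonic_number_ge0.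
move=> h; rewrite /W big_split /=.
under eq_bigr do rewrite size_rcons.
under [X in _ + X]eq_bigr do rewrite after_rcons.
rewrite sum_moves_const sum_moves_sum; last exact: sum_harmonic_number.
by rewrite -natr1; ring.
Qed.

(* The expectation of (-1)^L when L is the length of the game with a single pile
   of size [n]. *)
Definition pile_sign (R : realType) (n : nat) : R :=
  match n with 0%N => 1 | 1%N => -1 | _ => 0 end.

Lemma sum_pile_sign (R : realType) (n : nat) :
  \sum_(0 <= u < n) pile_sign R u = - (n%:R * pile_sign R n).
Proof.
case: n => [|[|n]]; first by rewrite big_geq // mul0r oppr0.
  by rewrite big_nat1 mul1r opprK.
(* The terms at 0 and 1 cancel; the later ones vanish. *)
rewrite big_nat_recl // big_nat_recl // big1 ?mulr0 //=; ring.
Qed.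

Lemma pile_sign_prod_le1 (R : realType) (k : nat) (t : position k) :
  `|\prod_(i < k) pile_sign R (t i)| <= 1.
Proof.
rewrite normr_prod prodr_ile1 // => i _; rewrite normr_ge0 /=.
by case: (t i) => [|[|n]]; rewrite /= ?normrN ?normr1 ?normr0.
Qed.

Lemma probability_odd_play {R : realType} {d : measure_display}
    {T : measurableType d} {P : probability T R} {k : nat} {s : position k}
    {play : T -> seq (move k)} (b : bool) :
  random_play P s play ->
  P [set w | odd (size (play w)) = b] =
    ((1 + (-1) ^+ b * \prod_(i < k) pile_sign R (s i)) / 2)%:E.
Proof.
move=> rp.
(* On a complete play the product is 1 and [W] is the indicator of parity [b]. As the product always
   lies in [-1, 1], the added 1 makes [W] nonnegative. *)
pose W h : R := (1 + (-1) ^+ b * (-1) ^+ size h *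
                     \prod_(i < k) pile_sign R (after s h i)) / 2.
transitivity (W [::])%:E; last by rewrite /W mulr1.
rewrite -(integral_play_martingale rp (W := W)).
- rewrite -[X in P X](setIT _).
  rewrite -integral_indic //; last first.
    exact: (random_play_measurable rp [set h | odd (size h) = b]).
  apply: eq_integral => w _; congr _%:E; rewrite /W indicE.
  have /andP[_ /eqP e0] := random_play_complete rp w.
  rewrite big1 ?mulr1 => [|i _]; last by rewrite tokens0_pile.
  rewrite -[(-1) ^+ size _]signr_odd -signr_addb.
  have -> : (w \in [set w | odd (size (play w)) = b]) =
            (b == odd (size (play w))) by apply/idP/eqP; rewrite inE.
  clear; case: b (odd _) => -[];
    by rewrite /= ?expr0 ?expr1 ?subrr ?mul0r // divff.
- move=> h; rewrite divr_ge0 // -[(-1) ^+ size _]signr_odd -signr_addb.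
  have := pile_sign_prod_le1 R (after s h); rewrite ler_norml => /andP[].
  by case: (_ (+) _); rewrite ?expr0 ?expr1; lra.
move=> h; rewrite /W -mulr_suml big_split /=.
under [X in _ + X]eq_bigr do rewrite size_rcons after_rcons.
rewrite sum_moves_const -mulr_sumr sum_moves_prod; last exact: sum_pile_sign.
by rewrite exprS; ring.
Qed.

(** * Unit piles and the winner *)

Lemma size_add_tokens_after (k : nat) (t : position k) (h : seq (move k)) :
  (forall i, (t i <= 1)%N) -> legal_moves t h ->
  (size h + tokens (after t h) = tokens t)%N.
Proof.
elim: h t => //= m h IH t t1 /andP[lm lh].
have m1 : m.2 = 1%N.
  by apply/eqP; case/andP: lm => m0 mt; rewrite eqn_leq m0 (leq_trans mt).
rewrite -(tokens_after_move lm) m1 addn1 addSn IH // => i.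
by rewrite ffunE; case: ifP => // _; exact: leq_trans (leq_subr _ _) _.
Qed.

Definition parity_winner (c : convention) (b : bool) : player :=
  match c with
  | Normal => if b then Player1 else Player2
  | Misere => if b then Player2 else Player1
  end.

(** The last move has number [size h - 1], of parity opposite to the length; this fails for an empty
    play, since [0.-1] is 0. *)
Lemma winner_parity (c : convention) (k : nat) (h : seq (move k)) :
  (0 < size h)%N -> winner c h = parity_winner c (odd (size h)).
Proof.
rewrite /winner /mover /parity_winner.
by case: (size h) c => // n [] _ /=; case: odd.
Qed.

Lemma size_complete_play_gt0 (k : nat) (t : position k) (h : seq (move k)) :
  (0 < tokens t)%N -> complete_play t h -> (0 < size h)%N.
Proof. by case: h => // t0 /andP[_]; rewrite /= -leqn0 leqNgt t0. Qed.

Theorem theorem5 (R : realType) (c : convention) :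
  exists w : bool -> player, w true <> w false /\
  forall (k : nat) (s : position k) (d : measure_display)
    (T : measurableType d) (P : probability T R) (play : T -> seq (move k)),
  (1 <= k)%N -> (forall i, (1 <= s i)%N) -> random_play P s play ->
  [/\ (* (a) *)
      ('E_P[fun x : T => (size (play x))%:R])%E =
        (\sum_(i < k) \sum_(1 <= r < (s i).+1) (r%:R)^-1)%:E /\
      \sum_(i < k) \sum_(1 <= r < (s i).+1) (r%:R)^-1 =
        \sum_(i < k) harmonic_number R (s i),
      (* (b) *)
      (forall i, s i = 1%N) ->
        forall x : T, size (play x) = k /\ winner c (play x) = w (odd k)
    & (* (c) *)
      (exists i, (1 < s i)%N) ->
        forall p : player, P [set x : T | winner c (play x) = p] = (2^-1)%:E].
Proof.
exists (parity_winner c); split; first by case: c.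
move=> k s d T P play k_gt0 s_gt0 rp.
have s_tokens : (0 < tokens s)%N.
  rewrite /tokens (bigD1 (Ordinal k_gt0)) //= addn_gt0.
  by rewrite s_gt0.
have winE x : winner c (play x) = parity_winner c (odd (size (play x))).
  apply: winner_parity; apply: size_complete_play_gt0 s_tokens _.
  exact: random_play_complete rp x.
split.
- by split => //; exact: expectation_size_play.
- move=> s1 x; have /andP[lx /eqP ex] := random_play_complete rp x.
  have sk : size (play x) = k.
    rewrite -[LHS]addn0 -ex size_add_tokens_after // => [|i]; last by rewrite s1.
    rewrite /tokens (eq_bigr (fun=> 1%N)) => [|i _]; last exact: s1.
    by rewrite sum1_card card_ord.
  by rewrite winE sk.
move=> [i si] p.
(* Each player wins for exactly one parity of the length. *)
have [b bE] : exists b, forall a, (parity_winner c a = p) = (a = b).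
  by case: c p {winE} => -[]; [exists true|exists false|exists false|exists true];
    case; rewrite propeqE.
under eq_set do rewrite winE bE.
rewrite (probability_odd_play b rp) (bigD1 i) //=.
(* A pile larger than 1 has sign 0 and kills the product, leaving 1/2. *)
by case: (s i) si => [|[|n]] // _; rewrite mul0r mulr0 addr0 mul1r.
Qed.
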